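(* Let $\mathcal{V}$ be the von Stengel-Forges polytope of a two-player perfect-recall triangle-free extensive-form game. Then all vertices of $\mathcal{V}$ have integer $\{0,1\}$ coordinates.
   Context: A (finite) two-player extensive-form game is played on a finite rooted tree. Each nonterminal node belongs to Player 1, Player 2, or the chance player; edges leaving a node represent actions. For $i\in\{1,2\}$, the nodes of Player $i$ are partitioned into nonempty information sets; $\mathcal{I}_i$ is the set of information sets of Player $i$. All nodes of an information set $I$ have the same nonempty action set $A_I$. Sequences: $\Sigma_i=\{(I,a): I\in\mathcal{I}_i, a\in A_I\}\cup\{\varnothing\}$, where $\varnothing$ is the empty sequence. Perfect recall: for each $I\in\mathcal{I}_i$, all nodes of $I$ have the same ordered list of (information set, action) pairs of Player $i$ encountered on the path from the root. The parent sequence $\sigma(I)\in\Sigma_i$ is the last pair $(I',a')$ of Player $i$ encountered on the path from the root to any node of $I$, or $\varnothing$ if there is none. Connectedness: $I_1\in\mathcal{I}_1$ and $I_2\in\mathcal{I}_2$ are connected, $I_1\rightleftharpoons I_2$, if there are nodes $u\in I_1$, $v\in I_2$ such that $u$ is on the path from the root to $v$ or vice versa. Relevance: $(\sigma_1,\sigma_2)\in\Sigma_1\times\Sigma_2$ is relevant, $\sigma_1\bowtie\sigma_2$, if $\sigma_1=\varnothing$ or $\sigma_2=\varnothing$, or $\sigma_1=(I_1,a_1)$, $\sigma_2=(I_2,a_2)$ with $I_1\rightleftharpoons I_2$. $\Sigma_1\bowtie\Sigma_2$ is the set of relevant pairs. For $\sigma_1\in\Sigma_1$, $I_2\in\mathcal{I}_2$,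 write $\sigma_1\bowtie I_2$ if $\sigma_1=\varnothing$ or $\sigma_1=(I_1,a_1)$ with $I_1\rightleftharpoons I_2$; define $I_1\bowtie\sigma_2$ symmetrically. Triangle-freeness: for any two distinct $I_1,I_2\in\mathcal{I}_1$ with $\sigma(I_1)=\sigma(I_2)$ and any two distinct $J_1,J_2\in\mathcal{I}_2$ with $\sigma(J_1)=\sigma(J_2)$, it is never the case that $I_1\rightleftharpoons J_1$ and $I_2\rightleftharpoons J_2$ and $I_1\rightleftharpoons J_2$. The von Stengel-Forges polytope $\mathcal{V}$ is the set of all vectors $v\in\mathbb{R}_{\ge0}^{|\Sigma_1\bowtie\Sigma_2|}$, indexed by relevant sequence pairs, such that: (i) $v[\varnothing,\varnothing]=1$; (ii) $\sum_{a\in A_{I_1}}v[(I_1,a),\sigma_2]=v[\sigma(I_1),\sigma_2]$ for all $I_1\in\mathcal{I}_1$, $\sigma_2\in\Sigma_2$ with $I_1\bowtie\sigma_2$; (iii) $\sum_{a\in A_{I_2}}v[\sigma_1,(I_2,a)]=v[\sigma_1,\sigma(I_2)]$ for all $I_2\in\mathcal{I}_2$, $\sigma_1\in\Sigma_1$ with $\sigma_1\bowtie I_2$. *)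

(* Defs.v *)
From mathcomp Require Import all_boot all_order all_algebra.
From mathcomp Require Import reals.

Set Implicit Arguments.
Unset Strict Implicit.
Unset Printing Implicit Defensive.

Import Order.TTheory GRing.Theory Num.Theory.
Local Open Scope ring_scope.

(* A finite rooted tree, given by its parent map.  Parents being unique and the
   root having none, [tree_reach] also excludes cycles. *)
Record rtree := RTree {
  node : finType;
  root : node;
  parent : node -> option node;
  parent_root : parent root = None;
  tree_reach : forall u, connect [rel x y | parent y == Some x] root u
}.

Definition child (T : rtree) : rel (node T) := [rel u v | parent v == Some u].

(* [ancestor u v]: u is on the path from the root to v, endpoints included. *)
Definition ancestor (T : rtree) : rel (node T) := connect (@child T).

Definition terminal (T : rtree) (u : node T) : bool := [forall v, ~~ child u v].

(* The nodes on the path from the root to u, in that order: [ancestor] is a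
   total order on them. *)
Definition rootpath (T : rtree) (u : node T) : seq (node T) :=
  sort (@ancestor T) (enum [pred v | ancestor v u]).

Definition player : Type := bool.
Definition P1 : player := true.
Definition P2 : player := false.

(* [move v] is the action labelling the edge from the parent of v to v (it has
   no meaning when v is the root). *)
Definition moves (T : rtree) (L : finType) (move : node T -> L) (u : node T) :
  {set L} := [set move v | v in child u].

(* Chance probabilities and payoffs are left out: the polytope does not depend
   on them. *)
Record efg := EFG {
  tree :> rtree;
  label : finType;
  move : node tree -> label;
  move_inj : forall u, {in child u &, injective move};
  (* [None] is the chance player; the value at a terminal node is ignored *)
  owner : node tree -> option player;
  infosets : player -> {set {set node tree}};
  infosets_partition : forall i,
    partition (infosets i) [set u | ~~ terminal u & owner u == Some i];
  infosets_moves : forall i I, I \in infosets i ->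
    {in I &, forall u v, moves move u = moves move v}
}.

Definition infoset (G : efg) (i : player) : finType :=
  {I : {set node G} | I \in infosets G i}.

(* A_I; all nodes of I contribute the same set. *)
Definition action_set (G : efg) (i : player) (I : infoset G i) :
  {set label G} := \bigcup_(u in val I) moves (@move G) u.

Definition action (G : efg) (i : player) (I : infoset G i) : finType :=
  {a : label G | a \in action_set I}.

Definition infoact (G : efg) (i : player) : finType :=
  {I : infoset G i & action I}.

(* Sigma_i; [None] is the empty sequence. *)
Definition sequence (G : efg) (i : player) : finType := option (infoact G i).

Definition seq_at (G : efg) (i : player) (I : infoset G i) (a : action I) :
  sequence G i := Some (Tagged (@action G i) a).

(* The pair (I, a) of player i played on the edge entering v, if that edge
   leaves a node of player i; there is at most one such pair. *)
Definition entering (G : efg) (i : player) (v : node G) : option (infoact G i) :=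
  [pick p : infoact G i |
    (if parent v is Some u then u \in val (tag p) else false)
    && (move v == val (tagged p))].

Definition history (G : efg) (i : player) (u : node G) : seq (infoact G i) :=
  pmap (@entering G i) (rootpath u).

Definition perfect_recall (G : efg) : Prop :=
  forall (i : player) (I : infoset G i),
    {in val I &, forall u v, history i u = history i v}.

(* sigma(I); under perfect recall it does not depend on the picked node, and
   one exists because information sets are nonempty. *)
Definition parent_seq (G : efg) (i : player) (I : infoset G i) : sequence G i :=
  if [pick u in val I] is Some u then last None (map Some (history i u))
  else None.

Definition connected (G : efg) (i j : player)
    (I : infoset G i) (J : infoset G j) : bool :=
  [exists u in val I, exists v in val J, ancestor u v || ancestor v u].

Definition relevant (G : efg) (s1 : sequence G P1) (s2 : sequence G P2) : bool :=
  match s1, s2 with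
  | Some p1, Some p2 => connected (tag p1) (tag p2)
  | _, _ => true
  end.

Definition info_seq_relevant (G : efg) (i j : player)
    (I : infoset G i) (s : sequence G j) : bool :=
  if s is Some p then connected I (tag p) else true.

Definition relpair (G : efg) : finType :=
  {s : sequence G P1 * sequence G P2 | relevant s.1 s.2}.

Definition triangle_free (G : efg) : Prop :=
  forall (I1 I2 : infoset G P1) (J1 J2 : infoset G P2),
    I1 != I2 -> parent_seq I1 = parent_seq I2 ->
    J1 != J2 -> parent_seq J1 = parent_seq J2 ->
    ~ [/\ connected I1 J1, connected I2 J2 & connected I1 J2].

(* v[s1, s2].  The default value 0 is never used in [vsf_polytope]: under
   perfect recall every pair occurring there is relevant, see the lemmas
   [relevant_seq_at1], [relevant_seq_at2], [relevant_parent1] and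
   [relevant_parent2] below. *)
Definition entry (R : realType) (G : efg) (v : {ffun relpair G -> R})
    (s1 : sequence G P1) (s2 : sequence G P2) : R :=
  if insub (s1, s2) is Some p then v p else 0.

Definition vsf_polytope (R : realType) (G : efg) (v : {ffun relpair G -> R}) :
  Prop :=
  [/\ forall p, 0 <= v p,
      entry v None None = 1,
      forall (I1 : infoset G P1) (s2 : sequence G P2),
        info_seq_relevant I1 s2 ->
        \sum_(a : action I1) entry v (seq_at a) s2 = entry v (parent_seq I1) s2
    & forall (I2 : infoset G P2) (s1 : sequence G P1),
        info_seq_relevant I2 s1 ->
        \sum_(a : action I2) entry v s1 (seq_at a) = entry v s1 (parent_seq I2)].

(* Vertices as extreme points. *)
Definition is_vertex (R : realType) (T : finType) (P : {ffun T -> R} -> Prop)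
    (v : {ffun T -> R}) : Prop :=
  P v /\
  forall (x y : {ffun T -> R}) (t : R), P x -> P y -> 0 < t < 1 ->
    (forall k, v k = t * x k + (1 - t) * y k) -> x = v /\ y = v.

Lemma connectedC (G : efg) (i j : player) (I : infoset G i) (J : infoset G j) :
  connected I J = connected J I.
Proof.
by apply/idP/idP => /exists_inP[u uI /exists_inP[v vJ uv]];
  apply/exists_inP; exists v => //; apply/exists_inP; exists u => //;
  rewrite orbC.
Qed.

Lemma relevant_seq_at1 (G : efg) (I : infoset G P1) (a : action I)
    (s : sequence G P2) : info_seq_relevant I s -> relevant (seq_at a) s.
Proof. by case: s. Qed.

Lemma relevant_seq_at2 (G : efg) (J : infoset G P2) (a : action J)
    (s : sequence G P1) : info_seq_relevant J s -> relevant s (seq_at a).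
Proof. by case: s => //= p; rewrite connectedC. Qed.

Lemma ancestor_comparable (T : rtree) (u v w : node T) :
  ancestor u w -> ancestor v w -> ancestor u v || ancestor v u.
Proof.
move=> /connectP[p]; elim/last_ind: p w => [|p x IHp] w /=.
  by move=> _ -> ->; rewrite orbT.
rewrite rcons_path last_rcons => /andP[up cx] -> /connectP[q].
case/lastP: q => [|q y] /=.
  move=> _ <-; apply/orP; left; apply: connect_trans (connect1 cx).
  by apply/connectP; exists p.
rewrite rcons_path last_rcons => /andP[vq cy] eq_xy; subst y.
apply: (IHp _ up erefl); apply/connectP; exists q => //.
by move: cx cy; rewrite /child /= => /eqP -> /eqP[].
Qed.

Lemma parent_seqP (G : efg) (i : player) (I : infoset G i) p (u : node G) :
  perfect_recall G -> u \in val I -> parent_seq I = Some p ->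
  exists2 w, w \in val (tag p) & ancestor w u.
Proof.
move=> pr uI; rewrite /parent_seq; case: pickP => // u0 u0I.
rewrite (pr i I u0 u) // => def_p.
have: p \in history i u.
  by move: def_p; case/lastP: (history i u) => // s x;
    rewrite map_rcons last_rcons mem_rcons inE => -[->]; rewrite eqxx.
rewrite mem_pmap => /mapP[x]; rewrite mem_sort mem_enum inE => xu.
rewrite /entering; case: pickP => // q /andP[wq _] [->].
move: wq; case def_w: (parent x) => [w|] // wq; exists w => //.
by apply: connect_trans xu; apply: connect1; rewrite /child /= def_w.
Qed.

Lemma parent_connected (G : efg) (i j : player) (I : infoset G i)
    (J : infoset G j) p :
  perfect_recall G -> connected I J -> parent_seq I = Some p ->
  connected (tag p) J.
Proof.
move=> pr /exists_inP[u uI /exists_inP[v vJ uv]] def_p.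
have [w wp wu] := parent_seqP pr uI def_p.
apply/exists_inP; exists w => //; apply/exists_inP; exists v => //.
case/orP: uv => [uv | vu]; first by rewrite [ancestor w v](connect_trans wu uv).
exact: ancestor_comparable wu vu.
Qed.

Lemma relevant_parent1 (G : efg) (I : infoset G P1) (s : sequence G P2) :
  perfect_recall G -> info_seq_relevant I s -> relevant (parent_seq I) s.
Proof.
case: s => [q|] pr /=; last by case: (parent_seq I).
by case def_p: (parent_seq I) => [p|] // cIq; apply: parent_connected def_p.
Qed.

Lemma relevant_parent2 (G : efg) (J : infoset G P2) (s : sequence G P1) :
  perfect_recall G -> info_seq_relevant J s -> relevant s (parent_seq J).
Proof.
case: s => [q|] pr //=; case def_p: (parent_seq J) => [p|] // cJq.
by rewrite connectedC; apply: parent_connected def_p.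
Qed.

(* Main.v *)
(* If w is a 0/1 point of V whose support lies in that of v, then for small
   t > 0 the point (v - t w) / (1 - t) is again in V, so a vertex v must equal
   w.  It thus suffices to find such a w for every v in V.  Take w to be the
   product of two pure plans, built by choosing actions at information sets one
   at a time, keeping v positive on all relevant pairs of chosen sequences.  An
   action can be chosen at I if the opponent's decided information sets
   connected to I form a chain: the constraint of V for I and the deepest of
   them provides one, and v increases towards the root.  Deciding I preserves
   the chain condition unless I is blocked by some undecided J connected to both
   I and a decided information set incomparable with I.  If I has maximal depth
   and J blocks I, then J is not blocked: by triangle-freeness, an information
   set blocking J would be deeper than I. *)

Require Import Defs.
From mathcomp Require Import all_boot all_order all_algebra.
From mathcomp Require Import reals.

Set Implicit Arguments.
Unset Strict Implicit.
Unset Printing Implicit Defensive.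

(* The information sets of both players are put in one type: [conn] only
   relates opponents.  [pos] is positivity of v at a pair of sequences, one for
   each player, [None] being the empty sequence of either player. *)
Record forest_pair := ForestPair {
  info : finType;
  act : finType;
  owner_info : act -> info;
  par : info -> option act;
  conn : rel info;
  pos : rel (option act);
  rank : info -> nat;
  rank_par : forall I s, par I = Some s -> rank (owner_info s) < rank I;
  conn_sym : symmetric conn;
  conn_irr : irreflexive conn;
  conn_par : forall I J s,
    conn I J -> par I = Some s -> conn (owner_info s) J;
  conn_triangle : forall I1 I2 J1 J2,
    I1 != I2 -> par I1 = par I2 -> J1 != J2 -> par J1 = par J2 ->
    ~ [/\ conn I1 J1, conn I2 J2 & conn I1 J2];
  pos_sym : symmetric pos;
  pos_root : pos None None;
  pos_par : forall s t, conn (owner_info s) (owner_info t) ->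
    pos (Some s) (Some t) -> pos (Some s) (par (owner_info t));
  pos_act : forall I (t : option act),
    (if t is Some q then conn I (owner_info q) else true) -> pos (par I) t ->
    exists2 s, owner_info s = I & pos (Some s) t
}.

(** * Ancestry in the forests and partial plans *)

Definition above (D : forest_pair) : rel (info D) :=
  connect [rel K I | omap (@owner_info D) (par I) == Some K].

Definition comparable (D : forest_pair) (I K : info D) : bool :=
  above I K || above K I.

Definition depth (D : forest_pair) (I : info D) : nat :=
  #|[set K | above K I]|.

Definition decided (D : forest_pair) (Z : {set act D}) : {set info D} :=
  [set owner_info s | s in Z].

Definition available (D : forest_pair) (Z : {set act D}) (I : info D) : bool :=
  (I \notin decided Z) && (if par I is Some s then s \in Z else true).

(** The first two clauses make [Z] a partial pure plan of each player, deciding only where the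
    player's own choices lead. The chain condition is imposed only on information sets that may be
    decided next. *)
Definition partial_plan (D : forest_pair) (Z : {set act D}) : Prop :=
  [/\ {in Z, forall s t, par (owner_info s) = Some t -> t \in Z},
      {in Z &, injective (@owner_info D)},
      {in Z, forall s, pos (Some s) None},
      {in Z &, forall s t, conn (owner_info s) (owner_info t) ->
         pos (Some s) (Some t)}
    & forall I, available Z I ->
        {in decided Z &, forall K L, conn I K -> conn I L -> comparable K L}].

Section ForestPair.
Variable D : forest_pair.
Implicit Types (I J K L : info D) (s t : act D) (Z : {set act D}).

(** Induction from the roots downwards, well-founded thanks to [rank]. *)
Lemma par_ind (P : info D -> Prop) :
  (forall I, (forall s, par I = Some s -> P (owner_info s)) -> P I) ->
  forall I, P I.
Proof.
move=> step I; have [n] := ubnP (rank I); elim: n I => // n IHn I ltIn.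
apply: step => s /rank_par lt_sI; apply: IHn.
exact: leq_trans lt_sI ltIn.
Qed.

Lemma aboveE K I :
  above K I =
  (K == I) || (if par I is Some s then above K (owner_info s) else false).
Proof.
apply/idP/orP => [/connectP[p]|[/eqP->|]]; last 2 first.
- exact: connect0.
- case def_s: (par I) => [s|] // Ks; apply: connect_trans Ks (connect1 _).
  by rewrite /= def_s.
case/lastP: p => [_ ->|p L]; first by left.
rewrite rcons_path last_rcons => /andP[Kp Lp] ->; right.
move: Lp => /=; case: (par L) => [s|] //= /eqP[->].
by apply/connectP; exists p.
Qed.

Lemma above_refl I : above I I.
Proof. exact: connect0. Qed.

Lemma above_trans I J K : above I J -> above J K -> above I K.
Proof. exact: connect_trans. Qed.

Lemma above_rank K I : above K I -> rank K <= rank I.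
Proof.
elim/par_ind: I => I IH; rewrite aboveE => /orP[/eqP-> //|].
case def_s: (par I) => [s|] // /(IH _ def_s) /leq_trans; apply.
exact/ltnW/rank_par.
Qed.

(** If [I] were strictly above [K], it would be above the owner of the shared parent action, whose
    rank is smaller than that of [I]. *)
Lemma siblings_above I K : par I = par K -> above I K -> I = K.
Proof.
rewrite aboveE => eqIK /orP[/eqP//|].
case def_s: (par K) => [s|] // /above_rank; rewrite leqNgt.
by rewrite rank_par // eqIK.
Qed.

Lemma siblings_comparable I K : par I = par K -> comparable I K -> I = K.
Proof. by move=> eqIK /orP[] /siblings_above->. Qed.

Lemma conn_above K I J : above K I -> conn I J -> conn K J.
Proof.
elim/par_ind: I => I IH; rewrite aboveE => /orP[/eqP-> //|].
case def_s: (par I) => [s|] // Ks cIJ; apply: IH Ks _ => //.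
exact: conn_par def_s.
Qed.

Lemma depth_par I :
  depth I = (if par I is Some s then depth (owner_info s) else 0).+1.
Proof.
rewrite /depth; case def_s: (par I) => [s|].
  have ->: [set K | above K I] = I |: [set K | above K (owner_info s)].
    by apply/setP=> K; rewrite !inE aboveE def_s.
  rewrite cardsU1 inE; case: (boolP (above I _)) => // /above_rank.
  by rewrite leqNgt rank_par.
rewrite (_ : [set K | _] = [set I]) ?cards1 //.
by apply/setP=> K; rewrite !inE aboveE def_s orbF.
Qed.

Lemma depth_above K I : above K I -> depth K <= depth I.
Proof.
move=> KI; apply/subset_leq_card/subsetP => L; rewrite !inE => LK.
exact: above_trans LK KI.
Qed.

Lemma root_above I : exists2 J, above J I & par J = None.
Proof.
elim/par_ind: I => I IH; case def_s: (par I) => [s|].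
  have [J Js J0] := IH _ def_s; exists J => //.
  by rewrite aboveE def_s Js orbT.
by exists I => //; apply: above_refl.
Qed.

Lemma above_step K I : above K I -> K != I ->
  exists J, exists2 s, above J I & par J = Some s /\ owner_info s = K.
Proof.
elim/par_ind: I => I IH; rewrite aboveE => /orP[/eqP->|].
  by rewrite eqxx.
case def_s: (par I) => [s|] // Ks _.
have [eqKs|neqKs] := eqVneq K (owner_info s).
  by exists I; exists s => //; apply: above_refl.
have [J [t Js Jt]] := IH _ def_s Ks neqKs; exists J; exists t => //.
by rewrite aboveE def_s Js orbT.
Qed.

(** [J] is where the branch down to [K] leaves the branch down to [I]. *)
Lemma above_exit I K : ~~ above K I ->
  exists J, [/\ above J K, ~~ above J I
              & forall s, par J = Some s -> above (owner_info s) I].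
Proof.
elim/par_ind: K => K IH nKI; case def_s: (par K) => [s|]; last first.
  by exists K; split; rewrite ?above_refl ?def_s.
have [sI|nsI] := boolP (above (owner_info s) I).
  by exists K; split; rewrite ?above_refl // => t; rewrite def_s => -[<-].
have [J [Js nJI parJ]] := IH _ def_s nsI; exists J; split => //.
by rewrite aboveE def_s Js orbT.
Qed.

(** * Decided, available and blocking information sets *)

Lemma decided_above Z K I : partial_plan Z ->
  above K I -> I \in decided Z -> K \in decided Z.
Proof.
move=> [cl _ _ _ _]; elim/par_ind: I => I IH.
rewrite aboveE => /orP[/eqP-> //|]; case def_s: (par I) => [s|] // Ks.
case/imsetP=> t tZ defI; apply: IH Ks _ => //; apply: imset_f.
by apply: cl tZ _ _; rewrite -defI.
Qed.

Lemma available_above Z K I : partial_plan Z ->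
  available Z I -> above K I -> K != I -> K \in decided Z.
Proof.
move=> pZ /andP[_ avI]; rewrite aboveE => /orP[->//|].
case def_s: (par I) avI => [s|] // sZ Ks _.
by apply: decided_above pZ Ks _; apply: imset_f.
Qed.

Lemma decided_par Z K s :
  partial_plan Z -> K \in decided Z -> par K = Some s -> s \in Z.
Proof. by case=> cl _ _ _ _ /imsetP[t tZ ->]; apply: cl. Qed.

(** The branches to [I] and [K] either start at distinct roots or part below a common information
    set. In the latter case both follow an action of [Z] there, and [Z] holds only one. *)
Lemma diverging_siblings Z I K : partial_plan Z -> available Z I ->
  K \in decided Z -> ~~ comparable I K ->
  exists I1 K1, [/\ above I1 I, above K1 K, I1 != K1 & par I1 = par K1].
Proof.
move=> pZ avI KZ; rewrite negb_or => /andP[nIK nKI].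
have [K1 [K1K nK1I parK1]] := above_exit nKI.
have K1Z := decided_above pZ K1K KZ.
have neqK1 J : above J I -> J != K1 by apply: contraTneq => ->.
case def_s: (par K1) => [s|]; last first.
  have [J JI J0] := root_above I; exists J, K1.
  by split; rewrite ?neqK1 ?J0.
have sI := parK1 _ def_s.
have sK : above (owner_info s) K.
  by apply: above_trans K1K; rewrite aboveE def_s above_refl orbT.
have neq_sI : owner_info s != I by apply: contraNneq nIK => <-.
have [J [t JI [def_t eq_ts]]] := above_step sI neq_sI.
exists J, K1; split; rewrite ?neqK1 // def_t def_s; congr Some.
have sZ := decided_par pZ K1Z def_s.
have tZ : t \in Z.
  have [eqJI|neqJI] := eqVneq J I.
    by case/andP: avI => _; rewrite -eqJI def_t.
  exact: decided_par (available_above pZ avI JI neqJI) def_t.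
by case: pZ => _ inj _ _ _; apply: inj.
Qed.

(** Let [I1] and [K1] be the siblings where the branches part. If [I1] were not [I], it would be
    decided, and the chain condition at [J] would make the distinct siblings [I1] and [K1]
    comparable. *)
Lemma decided_sibling Z I J K : partial_plan Z ->
  available Z I -> available Z J -> K \in decided Z ->
  conn J I -> conn J K -> ~~ comparable I K ->
  exists K1, [/\ above K1 K, K1 \in decided Z, conn J K1, K1 != I
               & par K1 = par I].
Proof.
move=> pZ avI avJ KZ cJI cJK nIK.
have [I1 [K1 [I1I K1K neqIK eq_par]]] := diverging_siblings pZ avI KZ nIK.
have K1Z := decided_above pZ K1K KZ.
have cK1 : conn J K1 by rewrite conn_sym (conn_above K1K) // conn_sym.
have cI1 : conn J I1 by rewrite conn_sym (conn_above I1I) // conn_sym.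
have [eqI1|neqI1] := eqVneq I1 I.
  by exists K1; split; rewrite // -eqI1 // eq_sym.
have I1Z := available_above pZ avI I1I neqI1.
case: pZ => _ _ _ _ chain; case/eqP: neqIK.
exact: siblings_comparable eq_par (chain J avJ _ _ I1Z K1Z cI1 cK1).
Qed.

(* Deciding I would break the chain condition at J. *)
Definition blocks Z J I : bool :=
  [&& available Z J, conn J I
    & [exists K in decided Z, conn J K && ~~ comparable I K]].

Lemma blocks_sibling Z J I : partial_plan Z -> available Z I -> blocks Z J I ->
  exists K, [/\ K \in decided Z, conn J K, K != I & par K = par I].
Proof.
move=> pZ avI /and3P[avJ cJI /exists_inP[K KZ /andP[cJK nIK]]].
have [K1 [_ K1Z cJK1 neqK1 eqK1]] := decided_sibling pZ avI avJ KZ cJI cJK nIK.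
by exists K1.
Qed.

(** Blocking yields decided siblings [K] of [I1] and [J'] of [J1]. If [K] and [I2] are comparable,
    the undecided [I2] is strictly below [K], which is as deep as [I1]. Otherwise [I2] has a decided
    sibling [K1] connected to [J1], and [I2], [K1], [J'], [J1] form the forbidden pattern. *)
Lemma blocks_depth Z I1 J1 I2 : partial_plan Z -> available Z I1 ->
  blocks Z J1 I1 -> blocks Z I2 J1 -> depth I1 < depth I2.
Proof.
move=> pZ avI1 bJ1 bI2.
have [K [KZ cJK neqK eqK]] := blocks_sibling pZ avI1 bJ1.
have [avJ1 cJ1I1 _] := and3P bJ1; have [avI2 cI2J1 _] := and3P bI2.
have [J' [J'Z cI2J' neqJ' eqJ']] := blocks_sibling pZ avJ1 bI2.
have nI2Z : I2 \notin decided Z by case/andP: avI2.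
have [|nI2K] := boolP (comparable I2 K).
  case/orP=> [/(decided_above pZ)/(_ KZ)|KI2]; first by rewrite (negPf nI2Z).
  have neqKI2 : K != I2 by apply: contraNneq nI2Z => <-.
  move: KI2; rewrite aboveE (negPf neqKI2) /=.
  case def_s: (par I2) => [s|] // /depth_above.
  by rewrite depth_par eqK -depth_par (depth_par I2) def_s.
have cJ1I2 : conn J1 I2 by rewrite conn_sym.
have [K1 [_ _ cK1 neqK1 eqK1]] :=
  decided_sibling pZ avI2 avJ1 KZ cJ1I2 cJK nI2K.
case: (@conn_triangle D I2 K1 J' J1); rewrite // 1?eq_sym //.
by split=> //; rewrite conn_sym.
Qed.

Lemma unblocked_exists Z I : partial_plan Z -> available Z I ->
  exists2 J, available Z J & forall K, ~~ blocks Z K J.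
Proof.
move=> pZ avI.
have [I1 avI1 maxI1] := @arg_maxnP _ I (available Z) (@depth D) avI.
case: (pickP (blocks Z ^~ I1)) => [J1 bJ1|nb]; last first.
  by exists I1 => // K; rewrite nb.
exists J1; first by case/and3P: bJ1.
(* A blocker of [J1] would be available and deeper than [I1]. *)
move=> K; apply/negP => bK; have := blocks_depth pZ avI1 bJ1 bK.
by rewrite ltnNge; apply/negP/negPn/maxI1; case/and3P: bK.
Qed.

(** * Choosing compatible actions and completing a plan *)

(** Iterates [pos_par] upwards from [t]. The climb stays in [Z], so at the owner of [t'] it meets
    [t'] itself. *)
Lemma pos_above Z s t t' : partial_plan Z -> t \in Z -> t' \in Z ->
  conn (owner_info s) (owner_info t) -> pos (Some s) (Some t) ->
  above (owner_info t') (owner_info t) -> pos (Some s) (Some t').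
Proof.
move=> pZ tZ t'Z; have [cl inj _ _ _] := pZ.
move defI: (owner_info t) => I; elim/par_ind: I => I IH in t tZ defI *.
rewrite conn_sym => cIs post; rewrite aboveE => /orP[/eqP eqt'|].
  by rewrite (inj t' t) // eqt'.
case def_q: (par I) => [q|] // t'q.
have qZ : q \in Z by apply: (cl t tZ); rewrite defI.
apply: (IH q def_q q) => //.
  by rewrite conn_sym (conn_par cIs).
by rewrite -def_q -defI; apply: pos_par; rewrite // defI conn_sym.
Qed.

Lemma pos_None s t :
  conn (owner_info s) (owner_info t) -> pos (Some s) (Some t) ->
  pos (Some s) None.
Proof.
move defI: (owner_info t) => I; elim/par_ind: I => I IH in t defI *.
rewrite -defI => cst /(pos_par cst); rewrite defI.
case def_q: (par I) => [q|] //; apply: (IH q def_q q) => //.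
by rewrite conn_sym (@conn_par D I) // conn_sym -defI.
Qed.

Lemma compatible_action Z I : partial_plan Z -> available Z I ->
  exists s, [/\ owner_info s = I, pos (Some s) None
    & {in Z, forall t, conn I (owner_info t) -> pos (Some s) (Some t)}].
Proof.
move=> pZ avI; have [cl inj pos0 pos1 chain] := pZ.
have par0 : pos (par I) None.
  case/andP: avI => _; case: (par I) => [p /pos0//|_]; exact: pos_root.
(* Without a connected chosen action, any action at [I] that is positive against the empty sequence
   will do; otherwise [s] is chosen against the deepest connected one. *)
case: (pickP [pred t in Z | conn I (owner_info t)]) => [t0 t0P|none];
  last first.
  have [s sI ps] := @pos_act D I None isT par0.
  by exists s; split=> // t tZ cIt; have:= none t; rewrite /= tZ cIt.
case: (@arg_maxnP _ t0 _ (fun t => depth (owner_info t)) t0P) => t.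
case/andP=> tZ cIt maxt.
have part : pos (par I) (Some t).
  case/andP: avI => _; case def_p: (par I) => [p|] pZ'.
    by apply: pos1 => //; apply: conn_par def_p.
  by rewrite pos_sym; apply: pos0.
have [s sI ps] := @pos_act D I (Some t) cIt part.
exists s; split=> //; first by apply: pos_None ps; rewrite sI.
move=> t' t'Z cIt'; have le_t' := maxt t'; rewrite /= t'Z cIt' in le_t'.
apply: (@pos_above Z s t) => //; rewrite ?sI //.
have /orP[// | tt'] : comparable (owner_info t') (owner_info t).
  by apply: (chain I) => //; apply: imset_f.
(* If [t] is the upper one, maximal depth leaves only equality of the owners. *)
move: tt'; rewrite aboveE => /orP[/eqP->|]; first exact: above_refl.
case def_q: (par _) => [q|] // /depth_above le_tq.
by have := leq_trans (le_t' isT) le_tq; rewrite depth_par def_q ltnn.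
Qed.

Lemma extend_plan Z I : partial_plan Z -> available Z I ->
  (forall J, ~~ blocks Z J I) ->
  exists2 s, s \notin Z & partial_plan (s |: Z).
Proof.
move=> pZ avI unbl; have [cl inj pos0 pos1 chain] := pZ.
have [s [sI ps pst]] := compatible_action pZ avI.
have [nIZ parI] := andP avI.
have nsZ : s \notin Z by apply: contra nIZ => sZ; rewrite -sI imset_f.
have neqI t : t \in Z -> owner_info t <> I.
  by move=> tZ def_t; rewrite -def_t imset_f in nIZ.
exists s => //; split.
- move=> t + q; rewrite !inE => /orP[/eqP->|tZ def_q].
    by rewrite sI => def_q; rewrite def_q in parI; rewrite parI orbT.
  by rewrite (cl t tZ) ?orbT.
- move=> t t'; rewrite !inE => /orP[/eqP->|tZ] /orP[/eqP->|t'Z] //.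
  + by rewrite sI => /esym/neqI; case.
  + by rewrite sI => /neqI; case.
  + exact: inj.
- by move=> t; rewrite !inE => /orP[/eqP->|/pos0].
- move=> t t'; rewrite !inE => /orP[/eqP->|tZ] /orP[/eqP->|t'Z].
  + by rewrite conn_irr.
  + by rewrite sI; apply: pst.
  + by rewrite sI pos_sym conn_sym; apply: pst.
  + exact: pos1.
have decU K : (K \in decided (s |: Z)) = (K == I) || (K \in decided Z).
  by rewrite /decided imsetU1 sI !inE.
move=> J /andP[]; rewrite decU negb_or => /andP[neqJI nJZ] parJ.
(* If [J] was available before, the only new comparisons involve [I], and [J] does not block [I]. *)
have [avJ | nparJ] := boolP (available Z J).
  have bad K : K \in decided Z -> conn J K -> conn J I -> comparable I K.
    move=> KZ cJK cJI; apply: contraNT (unbl J) => nIK.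
    by rewrite /blocks avJ cJI; apply/exists_inP; exists K => //; apply/andP.
  move=> K L; rewrite !decU => /orP[/eqP->|KZ] /orP[/eqP->|LZ] cJK cJL.
  + by rewrite /comparable above_refl.
  + exact: bad.
  + by rewrite /comparable orbC; apply: bad.
  + exact: chain avJ _ _ KZ LZ cJK cJL.
(* A newly available [J] is a child of [s], so whatever is connected to [J] is connected to [I]; the
   chain condition at [I] is inherited. *)
have def_s : par J = Some s.
  move: nparJ; rewrite /available nJZ /=; case: (par J) parJ => // t.
  by rewrite !inE => /orP[/eqP->|->].
have cIK K : conn J K -> conn I K by move/conn_par=> /(_ _ def_s); rewrite sI.
move=> K L; rewrite !decU => /orP[/eqP->|KZ] /orP[/eqP->|LZ] /cIK cK /cIK cL.
- by rewrite conn_irr in cK.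
- by rewrite conn_irr in cK.
- by rewrite conn_irr in cL.
- exact: chain avI _ _ KZ LZ cK cL.
Qed.

(** Greedy extension of the empty plan, by induction on the number of actions outside [Z]. *)
Lemma complete_plan :
  exists2 Z : {set act D}, partial_plan Z & forall I, ~~ available Z I.
Proof.
have: partial_plan (set0 : {set act D}).
  split=> [s|s t|s|s t|I _ K L]; rewrite ?inE //.
  by case/imsetP=> s; rewrite inE.
move: (set0) => Z; have [n] := ubnP #|~: Z|; elim: n Z => // n IHn Z ltZ pZ.
case: (pickP (available Z)) => [I avI | none]; last first.
  by exists Z => // I; rewrite none.
have [J avJ unbl] := unblocked_exists pZ avI.
have [s nsZ psZ] := extend_plan pZ avJ unbl.
apply: IHn psZ; rewrite -ltnS; apply: leq_ltn_trans ltZ.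
by rewrite (cardsD1 s (~: Z)) inE nsZ setDE setCU setIC.
Qed.

End ForestPair.

(** * Acyclicity of game trees and the rank of information sets *)

Import Order.TTheory GRing.Theory Num.Theory.
Local Open Scope ring_scope.

Lemma child_acyclic (T : rtree) (w x : node T) : child w x -> ~~ ancestor x w.
Proof.
have /connectP[p] := tree_reach x; elim/last_ind: p x w => [|p y IHp] x w /=.
  by move=> _ ->; rewrite /child /= parent_root.
rewrite rcons_path last_rcons => /andP[rp cy] -> {x}.
set l := last _ p in cy; have IH z := IHp l z rp erefl.
move=> cwy; have -> : w = l by move: cwy cy; rewrite /child /= => /eqP-> /eqP[].
(* A cycle through [y] also passes through its unique parent [l], where the induction hypothesis
   excludes it. *)
apply/negP => /connectP[q]; case/lastP: q => [_ eq_ly | q z].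
  by have := IH l; rewrite {2}eq_ly => /(_ cy); rewrite /ancestor connect0.
rewrite rcons_path last_rcons => /andP[yq cz] eq_lz; rewrite -eq_lz in cz.
case/negP: (IH _ cz); apply: (@connect_trans _ _ y); first exact: connect1.
by apply/connectP; exists q.
Qed.

Definition descendants (T : rtree) (u : node T) : nat :=
  #|[set w | ancestor u w]|.

Lemma descendants_child (T : rtree) (w x u : node T) :
  child w x -> ancestor x u -> (descendants u < descendants w)%N.
Proof.
move=> cwx xu; have wu : ancestor w u by apply: connect_trans (connect1 cwx) xu.
apply/proper_card/properP; split.
  by apply/subsetP=> z; rewrite !inE; apply: connect_trans.
exists w; rewrite inE; first exact: connect0.
by apply: contra (child_acyclic cwx); apply: connect_trans.
Qed.

(** Largest subtrees shrink away from the root; the subtraction turns this into an increasing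
    rank. *)
Definition infoset_rank (G : efg) (i : player) (I : infoset G i) : nat :=
  (#|node G| - \max_(u in val I) descendants u)%N.

Lemma infoset_rank_parent (G : efg) (i : player) (I : infoset G i) p :
  perfect_recall G -> parent_seq I = Some p ->
  (infoset_rank (tag p) < infoset_rank I)%N.
Proof.
move=> recall def_p.
have [u0 u0I] : exists u, u \in val I.
  by move: def_p; rewrite /parent_seq; case: pickP => // u; exists u.
have I_gt0 : (0 < #|val I|)%N by apply/card_gt0P; exists u0.
have [u uI maxu] := eq_bigmax_cond (@descendants G) I_gt0.
have [w wp lt_uw] : exists2 w,
    w \in val (tag p) & (descendants u < descendants w)%N.
  move: def_p; rewrite /parent_seq; case: pickP => // u1 u1I.
  (* Perfect recall replaces the arbitrary node defining [parent_seq] by the maximizing node [u]. *)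
  rewrite (recall i I u1 u) // => def_p.
  have: p \in history i u.
    by move: def_p; case/lastP: (history i u) => // s x;
      rewrite map_rcons last_rcons mem_rcons inE => -[->]; rewrite eqxx.
  rewrite mem_pmap => /mapP[x]; rewrite mem_sort mem_enum inE => xu.
  rewrite /entering; case: pickP => // q /andP[wq _] [->].
  move: wq; case def_w: (parent x) => [w|] // wq; exists w => //.
  by apply: descendants_child xu; rewrite /child /= def_w.
have lt_max : (\max_(u in val I) descendants u
               < \max_(u in val (tag p)) descendants u)%N.
  by rewrite maxu; apply: leq_trans lt_uw _; apply: leq_bigmax_cond.
(* Subtraction is truncated: strictness needs the smaller maximum to be below [#|node G|]. *)
apply: ltn_sub2l => //; apply: leq_trans lt_max _.
by apply/bigmax_leqP => z _; apply: max_card.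
Qed.

(** * Finite sums, and vertices determined by their support *)

Lemma sum_indicator (R : realType) (A : finType) (f : pred A) (b : bool) :
  (b -> exists a, f a) -> (forall a, f a -> b) ->
  (forall a a', f a -> f a' -> a = a') -> \sum_a (f a)%:R = b%:R :> R.
Proof.
case: b => [/(_ isT)[a fa] _ uniq | _ nf _]; last first.
  by apply: big1 => a _; case: (boolP (f a)) => [/nf|].
rewrite (bigD1 a) //= fa big1 ?addr0 // => a' neq.
by case: (boolP (f a')) => // fa'; rewrite (uniq _ _ fa fa') eqxx in neq.
Qed.

Lemma sum_gt0_exists (R : realType) (A : finType) (f : A -> R) :
  0 < \sum_a f a -> exists a, 0 < f a.
Proof.
move=> sum_gt0; apply/existsP; apply: contraLR sum_gt0; rewrite negb_exists.
move=> /forallP f_le0; rewrite -leNgt; apply: sumr_le0 => a _.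
by rewrite leNgt.
Qed.

Lemma le_sum_term (R : realType) (A : finType) (f : A -> R) a :
  (forall b, 0 <= f b) -> f a <= \sum_b f b.
Proof.
by move=> f_ge0; rewrite (bigD1 a) //= lerDl; apply: sumr_ge0.
Qed.

Section Polytope.
Variables (R : realType) (G : efg).
Implicit Types (v w : {ffun relpair G -> R}).

Lemma entry_val v (p : relpair G) : entry v (val p).1 (val p).2 = v p.
Proof. by rewrite /entry -surjective_pairing valK. Qed.

Lemma entry_ge0 v s1 s2 : (forall p, 0 <= v p) -> 0 <= entry v s1 s2.
Proof. by rewrite /entry => v_ge0; case: insubP. Qed.

Lemma entry_affine v w (t : R) s1 s2 :
  entry [ffun p => (v p - t * w p) / (1 - t)] s1 s2
  = (entry v s1 s2 - t * entry w s1 s2) / (1 - t).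
Proof.
rewrite /entry; case: insubP => [p _ _|_]; first by rewrite ffunE.
(* For irrelevant pairs all entries take the default value 0. *)
by rewrite mulr0 subr0 mul0r.
Qed.

(** The equations are affine and the coefficients of [v] and [w] add up to 1; the bound on [t * w p]
    gives nonnegativity. *)
Lemma polytope_remove v w (t : R) : vsf_polytope v -> vsf_polytope w ->
  t < 1 -> (forall p, t * w p <= v p) ->
  vsf_polytope [ffun p => (v p - t * w p) / (1 - t)].
Proof.
move=> [v0 v1 vI vJ] [w0 w1 wI wJ] t1 le_tw.
have t1' : 0 < 1 - t by rewrite subr_gt0.
split.
- by move=> p; rewrite ffunE; apply: divr_ge0; [rewrite subr_ge0|apply: ltW].
- by rewrite entry_affine v1 w1 mulr1 divff // gt_eqF.
- move=> I s rel; under eq_bigr do rewrite entry_affine.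
  by rewrite -mulr_suml sumrB -mulr_sumr vI // wI // entry_affine.
- move=> I s rel; under eq_bigr do rewrite entry_affine.
  by rewrite -mulr_suml sumrB -mulr_sumr vJ // wJ // entry_affine.
Qed.

Lemma vertex_of_support v w : is_vertex (@vsf_polytope R G) v ->
  vsf_polytope w -> (forall p, w p <= 1) -> (forall p, w p != 0 -> 0 < v p) ->
  w = v.
Proof.
move=> [Pv ext] Pw w1 supp; have [v0 _ _ _] := Pv.
(* The default [2^-1] keeps [t] below 1; the minimum gives [t * w p <= v p] because [w p <= 1]. *)
pose t : R := \big[Num.min/2^-1]_(p | w p != 0) v p.
have t0 : 0 < t.
  rewrite /t; elim/big_ind: _ => // [|x y x0 y0].
    by rewrite invr_gt0 ltr0n.
  by rewrite lt_min x0.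
have t1 : t < 1.
  apply: le_lt_trans (bigmin_le_id _ _ _ _) _.
  by rewrite invf_lt1 ?ltr1n ?ltr0n.
have le_tw p : t * w p <= v p.
  have [->|nz] := eqVneq (w p) 0; first by rewrite mulr0.
  have le_tv : t <= v p by apply: bigmin_le_cond.
  by apply: le_trans le_tv; rewrite ler_piMr // ltW.
have t01 : 0 < t < 1 by rewrite t0.
apply: proj1 (ext w _ t Pw (polytope_remove Pv Pw t1 le_tw) t01 _).
move=> p; rewrite ffunE [(1 - t) * _]mulrC divfK.
  by rewrite addrC subrK.
by rewrite subr_eq0 gt_eqF.
Qed.

End Polytope.

(** * The forest pair of a game and its 0/1 point *)

Section PureProfile.
Variables (R : realType) (G : efg) (v : {ffun relpair G -> R}).
Hypotheses (recall : perfect_recall G) (tfree : triangle_free G).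
Hypothesis (Pv : vsf_polytope v).

Let ginfo : finType := (infoset G P1 + infoset G P2)%type.
Let gact : finType := (infoact G P1 + infoact G P2)%type.

Let gowner (s : gact) : ginfo :=
  match s with inl p => inl (tag p) | inr q => inr (tag q) end.

Let gpar (I : ginfo) : option gact :=
  match I with
  | inl K => omap inl (parent_seq K)
  | inr J => omap inr (parent_seq J)
  end.

Let gconn (I J : ginfo) : bool :=
  match I, J with
  | inl K, inr L | inr L, inl K => connected K L
  | _, _ => false
  end.

(** Two nonempty sequences of the same player index no entry of [v], hence [false]. *)
Let gpos (x y : option gact) : bool :=
  match x, y with
  | Some (inl p), Some (inr q) | Some (inr q), Some (inl p) =>
      0 < entry v (Some p) (Some q)
  | Some (inl p), None | None, Some (inl p) => 0 < entry v (Some p) None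
  | Some (inr q), None | None, Some (inr q) => 0 < entry v None (Some q)
  | None, None => 0 < entry v None None
  | _, _ => false
  end.

Let grank (I : ginfo) : nat :=
  match I with inl K => infoset_rank K | inr J => infoset_rank J end.

Let gpos_lr (x : sequence G P1) (y : sequence G P2) :
  gpos (omap inl x) (omap inr y) = (0 < entry v x y).
Proof. by case: x; case: y. Qed.

Let gpos_sym : symmetric gpos.
Proof. by case=> [[p|p]|] [[q|q]|]. Qed.

Let grank_par I s : gpar I = Some s -> (grank (gowner s) < grank I)%N.
Proof.
by case: I => I /=; case def_p: (parent_seq I) => [p|] //= [<-] /=;
  apply: infoset_rank_parent.
Qed.

Let gconn_sym : symmetric gconn.
Proof. by case=> I [] J. Qed.

Let gconn_irr : irreflexive gconn.
Proof. by case. Qed.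

Let gconn_par I J s : gconn I J -> gpar I = Some s -> gconn (gowner s) J.
Proof.
case: I J => I [] J //= cIJ; case def_p: (parent_seq I) => [p|] //= [<-] /=.
  exact: parent_connected def_p.
by rewrite connectedC; apply: parent_connected def_p; rewrite // connectedC.
Qed.

Let gconn_triangle I1 I2 J1 J2 :
  I1 != I2 -> gpar I1 = gpar I2 -> J1 != J2 -> gpar J1 = gpar J2 ->
  ~ [/\ gconn I1 J1, gconn I2 J2 & gconn I1 J2].
Proof.
have omap_inj (A B : Type) (f : A -> B) : injective f -> injective (omap f).
  by move=> f_inj [x|] [y|] //= [/f_inj->].
case: I1 I2 J1 J2 => I1 [] I2 [] J1 [] J2; try by move=> _ _ _ _ [].
  move=> neqI eqI neqJ eqJ; apply: tfree.
  - by apply: contraNneq neqI => ->.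
  - by apply: omap_inj eqI => ? ? [].
  - by apply: contraNneq neqJ => ->.
  - by apply: omap_inj eqJ => ? ? [].
(* With the players exchanged, the forbidden path [J1], [I1], [J2], [I2] is read backwards. *)
move=> neqI eqI neqJ eqJ [c11 c22 c12]; apply: (@tfree J2 J1 I2 I1).
- by apply: contraNneq neqJ => ->.
- by apply: omap_inj (esym eqJ) => ? ? [].
- by apply: contraNneq neqI => ->.
- by apply: omap_inj (esym eqI) => ? ? [].
- by [].
Qed.

Let gpos_root : gpos None None.
Proof. by case: Pv => _ v1 _ _; rewrite /= v1 ltr01. Qed.

(** The parent entry is a sum of nonnegative entries, among them the given positive one. *)
Let gpos_par s t : gconn (gowner s) (gowner t) ->
  gpos (Some s) (Some t) -> gpos (Some s) (gpar (gowner t)).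
Proof.
case: Pv => v0 _ vI vJ; case: s t => [p|q] [[K a]|[K a]] //= cK pos_a.
  apply: etrans (gpos_lr (Some p) (parent_seq K)) _.
  rewrite -vJ; last by rewrite /= connectedC.
  apply: lt_le_trans pos_a _.
  apply: (le_sum_term (f := fun a => entry v (Some p) (seq_at a))) => b.
  exact: entry_ge0.
apply: etrans (gpos_sym _ _) (etrans (gpos_lr (parent_seq K) (Some q)) _).
rewrite -vI //; apply: lt_le_trans pos_a _.
apply: (le_sum_term (f := fun a => entry v (seq_at a) (Some q))) => b.
exact: entry_ge0.
Qed.

(** The constraint at [I] writes the positive parent entry as a sum, so some term is positive. *)
Let gpos_act I (t : option gact) :
  (if t is Some q then gconn I (gowner q) else true) -> gpos (gpar I) t ->
  exists2 s, gowner s = I & gpos (Some s) t.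
Proof.
case: Pv => _ _ vI vJ; case: I => K.
  move=> ct; have {ct} [t' -> ct] :
    exists2 t', t = omap inr t' & info_seq_relevant K t'.
    by case: t ct => [[q|q]|] // ct; [exists (Some q)|exists None].
  rewrite /= gpos_lr -vI // => /sum_gt0_exists[a pos_a].
  exists (inl (Tagged (@action G P1) a)) => //.
  exact: etrans (gpos_lr (seq_at a) t') pos_a.
move=> ct; have {ct} [t' -> ct] :
  exists2 t', t = omap inl t' & info_seq_relevant K t'.
  case: t ct => [[q|q]|] //= cq; last by exists None.
  by exists (Some q); rewrite //= connectedC.
rewrite gpos_sym /= gpos_lr -vJ // => /sum_gt0_exists[a pos_a].
exists (inr (Tagged (@action G P2) a)) => //.
exact: etrans (gpos_sym _ _) (etrans (gpos_lr t' (seq_at a)) pos_a).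
Qed.

Let game_forests : forest_pair :=
  @ForestPair ginfo gact gowner gpar gconn gpos grank grank_par gconn_sym
    gconn_irr gconn_par gconn_triangle gpos_sym gpos_root gpos_par gpos_act.

Lemma integral_point_in_support :
  exists w : {ffun relpair G -> R},
    [/\ vsf_polytope w, forall p, w p = 0 \/ w p = 1
      & forall p, w p != 0 -> 0 < v p].
Proof.
have [Z pZ full] := complete_plan game_forests.
have [cl inj pos0 pos1 _] := pZ.
pose played (x : option gact) := if x is Some s then s \in Z else true.
pose w : {ffun relpair G -> R} := [ffun p =>
  (played (omap inl (val p).1) && played (omap inr (val p).2))%:R].
(* The product form lets each constraint factor, leaving a condition on one player's plan. *)
have entry_w s1 s2 : relevant s1 s2 ->
    entry w s1 s2 = (played (omap inl s1))%:R * (played (omap inr s2))%:R.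
  by move=> rel; rewrite /entry insubT ffunE /= -natrM mulnb.
(* As nothing is available any more, an information set whose parent sequence is played is
   decided. *)
have playedP (K : ginfo) : played (gpar K) -> exists2 s, s \in Z & gowner s = K.
  move=> pK; have := full K; rewrite /available negb_and negbK.
  case/orP => [/imsetP[s sZ ->]|]; first by exists s.
  by move: pK; rewrite /played /=; case: (gpar K) => // s ->.
exists w; split.
- split.
  + by move=> p; rewrite ffunE ler0n.
  + by rewrite entry_w // mulr1.
  + move=> K s rel; rewrite entry_w ?relevant_parent1 //.
    under eq_bigr do rewrite entry_w ?relevant_seq_at1 //.
    rewrite -mulr_suml; congr (_ * _); apply: sum_indicator.
    * move=> /(playedP (inl K))[[p|p] // pZ' [eqK]].
      by case: p eqK pZ' => K' a /= eqK aZ; subst K'; exists a.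
    * move=> a aZ; rewrite /played; case def_p: (parent_seq K) => [p|] //=.
      by apply: cl aZ _ _; rewrite /= def_p.
    * move=> a b aZ bZ; have [eqab] := inj _ _ aZ bZ erefl.
      exact: eq_from_Tagged eqab.
  + move=> K s rel; rewrite entry_w ?relevant_parent2 //.
    under eq_bigr do rewrite entry_w ?relevant_seq_at2 //.
    rewrite -mulr_sumr; congr (_ * _); apply: sum_indicator.
    * move=> /(playedP (inr K))[[p|p] // pZ' [eqK]].
      by case: p eqK pZ' => K' a /= eqK aZ; subst K'; exists a.
    * move=> a aZ; rewrite /played; case def_p: (parent_seq K) => [p|] //=.
      by apply: cl aZ _ _; rewrite /= def_p.
    * move=> a b aZ bZ; have [eqab] := inj _ _ aZ bZ erefl.
      exact: eq_from_Tagged eqab.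
- by move=> p; rewrite ffunE; case: (_ && _); [right|left].
move=> p; rewrite ffunE -entry_val.
case: p => -[s1 s2] /= rel; rewrite pnatr_eq0 eqb0 negbK => /andP[].
(* For two nonempty sequences relevance is connectedness, as [pos1] requires; [pos0] treats a
   nonempty sequence against the empty one. *)
case: s1 rel => [p|]; case: s2 => [q|] //= rel pZ' qZ.
- exact: (pos1 _ _ pZ' qZ rel).
- exact: (pos0 _ pZ').
- exact: (pos0 _ qZ).
Qed.

End PureProfile.

Theorem theorem4 (R : realType) (G : efg)
    (recall : perfect_recall G) (tfree : triangle_free G)
    (v : {ffun relpair G -> R}) (vertex : is_vertex (@vsf_polytope R G) v) :
  forall p : relpair G, v p = 0 \/ v p = 1.
Proof.
have [w [Pw w01 supp]] :=
  integral_point_in_support recall tfree (proj1 vertex).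
rewrite -(vertex_of_support vertex Pw _ supp) // => p.
by case: (w01 p) => ->; rewrite ?ler01.
Qed.
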